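(* Let $A\in\mathbb{R}^{n\times n}$ have at least one non-real eigenvalue, let $b\in\mathbb{R}^n$ be such that $(A,b)$ is controllable, let $p\in\mathbb{R}^n$ with $\|p\|=1$, and let $m(t)=p^\top e^{-At}b$, $t\ge 0$, be the corresponding switching function, written as a finite sum $$m(t)=\sum_{\nu}e^{\alpha_\nu t}t^{d_\nu}H_\nu\cos(\omega_\nu t+\phi_\nu),$$ with $\alpha_\nu,\phi_\nu\in\mathbb{R}$, $d_\nu\in\{0,1,2,\dots\}$, $H_\nu>0$, $\omega_\nu\ge 0$, and at least one $\omega_\nu$ positive. Define $$\alpha_*:=\max_\nu\alpha_\nu,\qquad d_*:=\max\{d_\nu:\alpha_\nu=\alpha_*\},\qquad \mathcal{D}:=\{\nu:\alpha_\nu=\alpha_*,\ d_\nu=d_*\},$$ $$Q(t):=\sum_{\nu\in\mathcal{D}}H_\nu\cos(\omega_\nu t+\phi_\nu).$$ Then, for $t>0$, $$m(t)=e^{\alpha_* t}t^{d_*}\bigl(Q(t)+P(t)\bigr),\quad\text{where } P(t)\to 0 \text{ and } \dot P(t)\to 0 \text{ as } t\to\infty.$$ Suppose furthermore that: (a) $Q\not\equiv 0$, and there exists $\gamma>0$ such that $|Q(t)|+|\dot Q(t)|\ge\gamma$ for all $t\ge 0$; (b) the complex function $z(t):=\sum_{\nu\in\mathcal{D}}H_\nu e^{\mathrm{i}(\omega_\nu t+\phi_\nu)}$ satisfies $z(t)\ne 0$ for all $t\ge 0$, and the mean motion $\Omega:=\lim_{t\to\infty}\frac{\arg z(t)}{t}$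 exists. Then there exists $t_*\ge 0$ such that the number $N(T,t_* )$ of switching points of $m$ on $[t_*,T]$ satisfies $$N(T,t_* )=N_Q(T,t_* )+O(1),$$ where $N_Q(T,t_* )$ is the number of zeros of $Q$ on $[t_*,T]$. In particular, $$N(T,t_* )\ge\frac{|\Omega|}{\pi}(T-t_* )+o(T-t_* )\quad\text{as } T\to\infty,$$ and hence $$\liminf_{T\to\infty}\frac{N(T,t_* )}{T}\ge\frac{|\Omega|}{\pi}.$$
   Context: The pair $(A,b)$ is controllable if $b,Ab,\dots,A^{n-1}b$ span $\mathbb{R}^n$. The function $m(t)=p^\top e^{-At}b$ is the (generic) switching function for the time-optimal control problem for $\dot x=Ax+bu$, $u(t)\in[-1,1]$; scaling $m$ by a nonzero constant does not change its zeros, so $p$ is normalized to $\|p\|=1$. The switching points of $m$ are by definition the zeros of $m$. The representation of $m$ as a finite sum comes from a Jordan decomposition of $-A$; terms with $\omega_\nu=0$ represent contributions of real eigenvalues. For a continuous nowhere-vanishing $z:[0,\infty)\to\mathbb{C}$, $\arg z(t)$ denotes a continuous branch of the argument along $z$ (not reduced modulo $2\pi$); the limit of $\arg z(t)/t$ does not depend on the branch. The terms $O(1)$ and $o(T-t_* )$ refer to $T\to\infty$ with $t_*$ fixed. *)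

(* Defs.v *)
From mathcomp Require Import all_boot all_order all_algebra.
From mathcomp Require Import all_classical all_reals all_analysis.
From mathcomp Require Import complex finmap.

Set Implicit Arguments.
Unset Strict Implicit.
Unset Printing Implicit Defensive.

Import Order.TTheory GRing.Theory Num.Theory.
Import numFieldNormedType.Exports.

Local Open Scope classical_set_scope.
Local Open Scope ring_scope.

Definition expmx (R : realType) (n : nat) (M : 'M[R]_n) : 'M[R]_n :=
  limn (series (fun k : nat => (k`!%:R)^-1 *: M ^+ k)).

Definition controllable (R : realType) (n : nat) (A : 'M[R]_n) (b : 'cV[R]_n) : Prop :=
  <<[seq A ^+ k *m b | k <- iota 0 n]>>%VS = fullv.

(* The library norm on matrices is the sup norm. *)
Definition enorm (R : realType) (n : nat) (p : 'cV[R]_n) : R :=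
  Num.sqrt (\sum_(i < n) p i 0 ^+ 2).

Definition has_nonreal_eigenvalue (R : realType) (n : nat) (A : 'M[R]_n) : Prop :=
  exists lambda : R[i],
    eigenvalue (map_mx (real_complex R) A) lambda /\ complex.Im lambda != 0.

Definition switching (R : realType) (n : nat) (A : 'M[R]_n) (b p : 'cV[R]_n) (t : R) : R :=
  (p^T *m expmx (- t *: A) *m b) 0 0.

Definition exp_trig_sum (R : realType) (k : nat) (alpha : 'I_k.+1 -> R)
    (d : 'I_k.+1 -> nat) (H omega phi : 'I_k.+1 -> R) (t : R) : R :=
  \sum_nu expR (alpha nu * t) * t ^+ d nu * H nu * cos (omega nu * t + phi nu).

Definition alpha_star (R : realType) (k : nat) (alpha : 'I_k.+1 -> R) : R :=
  \big[Num.max/alpha ord0]_nu alpha nu.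

(* The maximum is over a nonempty set, so the default value 0 plays no role. *)
Definition d_star (R : realType) (k : nat) (alpha : 'I_k.+1 -> R)
    (d : 'I_k.+1 -> nat) : nat :=
  \max_(nu | alpha nu == alpha_star alpha) d nu.

Definition dominant (R : realType) (k : nat) (alpha : 'I_k.+1 -> R)
    (d : 'I_k.+1 -> nat) : {set 'I_k.+1} :=
  [set nu | (alpha nu == alpha_star alpha) && (d nu == d_star alpha d)]%SET.

Definition dominant_part (R : realType) (k : nat) (alpha : 'I_k.+1 -> R)
    (d : 'I_k.+1 -> nat) (H omega phi : 'I_k.+1 -> R) (t : R) : R :=
  \sum_(nu in dominant alpha d) H nu * cos (omega nu * t + phi nu).

Definition expi (R : realType) (x : R) : R[i] := (cos x +i* sin x)%C.

Definition dominant_complex (R : realType) (k : nat) (alpha : 'I_k.+1 -> R)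
    (d : 'I_k.+1 -> nat) (H omega phi : 'I_k.+1 -> R) (t : R) : R[i] :=
  \sum_(nu in dominant alpha d) (H nu)%:C%C * expi (omega nu * t + phi nu).

Definition arg_branch (R : realType) (z : R -> R[i]) (theta : R -> R) : Prop :=
  {within `[0%R, +oo[, continuous theta} /\
  forall t : R, 0 <= t -> z t = `|z t| * expi (theta t).

(* The limit does not depend on the branch: for z continuous and nowhere zero
   on [0, +oo[, two branches differ by a constant. *)
Definition is_mean_motion (R : realType) (z : R -> R[i]) (Omega : R) : Prop :=
  exists theta : R -> R,
    arg_branch z theta /\ theta t / t @[t --> +oo] --> Omega.

Definition zeros (R : realType) (f : R -> R) (a T : R) : set R :=
  [set t | a <= t <= T /\ f t = 0].

(* Equal to 0 when there are infinitely many zeros, so any use must be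
   accompanied by the finiteness of [zeros f a T]. *)
Definition nzeros (R : realType) (f : R -> R) (a T : R) : nat :=
  #|` fset_set (zeros f a T)|%fset.

(* The Landau notations look up a [filter_on] instance for their filter; the
   library has one for [\oo] but none for [+oo]. *)
Canonical pinfty_filter_on (R : numFieldType) : filter_on R :=
  FilterType (pinfty_nbhs R) (@filter_filter R _ proper_pinfty_nbhs).

(* Main.v *)
(* Divide m by its dominant growth exp(alpha_star t) t^d_star: on t > 0 its
   zeros are those of F = Q + P, where P and P' are O(1/t) because every
   non-dominant term has growth ratio O(1/t).  Since |Q| + |Q'| >= gamma and Q'
   is Lipschitz, both Q and F are steep, with slope at least gamma/2 in absolute
   value, on a window of fixed radius L around each of their zeros.  Hence zeros
   of either function are more than L apart, and each zero of one has a zero of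
   the other within L/2; matching them changes the count only through the two
   ends of the interval, so the counts on [tstar, T] differ by at most 2.
   Finally Q = |z| cos theta vanishes whenever theta meets pi/2 + pi Z, so the
   intermediate value theorem gives at least
   |theta T - theta tstar| / pi - 1 zeros of Q. *)
Require Import Defs.
From mathcomp Require Import all_boot all_order all_algebra finmap.
From mathcomp Require Import all_classical all_reals all_analysis.
From mathcomp Require Import complex ring lra.
Import Order.TTheory GRing.Theory Num.Theory.
Import numFieldNormedType.Exports.
Local Open Scope classical_set_scope.
Local Open Scope ring_scope.

Set Implicit Arguments.
Unset Strict Implicit.
Unset Printing Implicit Defensive.

(** * Counting separated points and matching zeros *)

(* Points of X are more than L apart, so choosing for each of them a point of Y
   within L/2 is an injection. *)
Lemma card_le_separated (R : realType) (X Y : {fset R}) (L : R) :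
  (forall x y, x \in X -> y \in X -> x != y -> L < `|x - y|) ->
  (forall x, x \in X -> exists2 y, y \in Y & `|x - y| <= L / 2) ->
  (#|` X| <= #|` Y|)%N.
Proof.
move=> sepX XY.
pose h x := xget 0 [set y | y \in Y /\ `|x - y| <= L / 2].
have hP x : x \in X -> h x \in Y /\ `|x - h x| <= L / 2.
  move=> /XY[y yY xy]; rewrite /h.
  by case: xgetP => [_ -> //|/(_ y)]; case.
have /card_in_imfsetP/eqP <- : {in X &, injective h}.
  move=> x y xX yX hxy; apply/eqP/negPn/negP => /(sepX _ _ xX yX).
  have [_ hx] := hP x xX; have [_ hy] := hP y yX.
  have := ler_distD (h x) x y; rewrite (distrC (h x)) {2}hxy.
  by move=> h1 h2; lra.
apply/fsubset_leq_card/fsubsetP => _ /imfsetP[x /= xX ->].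
by have [] := hP x xX.
Qed.

(** Cut the line from [a] on into half-open cells of length [L]. Two points in one cell are less
    than [L] apart, so sending a point to the index of its cell is injective on [X], and only the
    cells that meet [[a, T]] are hit. *)
Lemma finite_separated (R : realType) (X : set R) (a T L : R) : 0 < L ->
  (forall x, X x -> a <= x <= T) ->
  (forall x y, X x -> X y -> x != y -> L < `|x - y|) -> finite_set X.
Proof.
move=> L0 XaT sepX.
pose f x := Num.trunc ((x - a) / L).
have fX x : X x -> (f x)%:R <= (x - a) / L < (f x).+1%:R.
  by move=> /XaT/andP[ax _]; rewrite truncn_itv // divr_ge0 ?subr_ge0 // ltW.
have fI : {in X &, injective f}.
  move=> x y /set_mem xX /set_mem yX fxy.
  apply/eqP/negPn/negP => /(sepX _ _ xX yX).
  move: (fX x xX) (fX y yX); rewrite -fxy -(natr1 (f x)).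
  rewrite !ler_pdivlMr // !ltr_pdivrMr // => /andP[x1 x2] /andP[y1 y2].
  by apply/negP; rewrite -leNgt ler_norml; apply/andP; split; lra.
rewrite -(eq_finite_set (inj_card_eq fI)).
apply: (@sub_finite_set _ _ `I_(Num.trunc ((T - a) / L)).+1 _ (finite_II _)).
move=> _ [x xX <-] /=; rewrite ltnS le_truncn // ler_pM2r ?invr_gt0 //.
by have /andP[_ ?] := XaT x xX; rewrite lerD2r.
Qed.

(* A zero of f near an end of [a, T] may be matched with a zero of g outside
   [a, T]; it is then within L/2 of a or T, hence the two extra points. *)
Lemma nzeros_le_add2 (R : realType) (f g : R -> R) (a T L : R) :
  0 < L ->
  finite_set (zeros f a T) -> finite_set (zeros g a T) ->
  (forall x y, a <= x -> a <= y -> f x = 0 -> f y = 0 -> x != y ->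
     L < `|x - y|) ->
  (forall x, a <= x -> f x = 0 -> exists2 y, g y = 0 & `|x - y| <= L / 2) ->
  (nzeros f a T <= (nzeros g a T).+2)%N.
Proof.
move=> L0 ff fg sepf fg0.
apply: (@leq_trans #|` (a |` (T |` fset_set (zeros g a T)))%fset|); last first.
  by rewrite !cardfsU1 -[in X in (_ <= X)%N]add1n addnCA leq_add ?leq_b1 //
             -addn1 addnC leq_add ?leq_b1.
apply: (@card_le_separated _ _ _ L) => [x y|x].
  rewrite !in_fset_set // !inE => -[/andP[ax _] fx] [/andP[ay _] fy].
  exact: sepf.
rewrite in_fset_set // inE => -[/andP[ax xT] fx].
have [y gy xy] := fg0 x ax fx.
move: (xy); rewrite ler_norml => /andP[xy1 xy2].
have [ya|ya] := ltP y a.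
  by exists a; rewrite ?inE ?eqxx // ler_norml; apply/andP; split; lra.
have [yT|yT] := leP y T.
  exists y => //; rewrite !inE in_fset_set // [X in _ || (_ || X)]mem_set ?orbT //.
  by split=> //; apply/andP.
by exists T; rewrite ?inE ?eqxx ?orbT // ler_norml; apply/andP; split; lra.
Qed.

(** * Functions that are steep around their zeros, and perturbation of zeros *)

(** The sign alternative stands outside the quantifier over [s]: with [c > 0] the slope keeps one
    sign on the whole window, so [f] is strictly monotone there. *)
Definition steep (R : realType) (f f' : R -> R) (x L c : R) : Prop :=
  (forall s, `|s - x| <= L -> is_derive s 1 f (f' s)) /\
  ((forall s, `|s - x| <= L -> c <= f' s) \/
   (forall s, `|s - x| <= L -> f' s <= - c)).

Lemma mean_value (R : realType) (f f' : R -> R) (x y : R) : x <= y ->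
  (forall s, x <= s <= y -> is_derive s 1 f (f' s)) ->
  exists2 s, x <= s <= y & f y - f x = f' s * (y - x).
Proof.
move=> xy df; have [||s sxy ->] := @MVT_segment R f f' x y xy.
- by move=> s; rewrite in_itv /= => /andP[/ltW xs /ltW sy]; apply: df; rewrite xs.
- apply: derivable_within_continuous => s; rewrite in_itv => /df.
  by case.
- by exists s; move: sxy; rewrite ?in_itv.
Qed.

(** Rolle: a second zero inside the window of [x] would force [f'] to vanish in that window.
    Steepness is needed at one of the two zeros only. *)
Lemma steep_separated (R : realType) (f f' : R -> R) (x y L c : R) : 0 < c ->
  steep f f' x L c -> f x = 0 -> f y = 0 -> x != y -> L < `|x - y|.
Proof.
move=> c0 [df sf] fx fy neq_xy; rewrite ltNge; apply/negP => xyL.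
have f'N0 s : `|s - x| <= L -> f' s != 0.
  by move=> sx; apply/eqP => f's; case: sf => /(_ s sx); rewrite f's => ?; lra.
(* Both orders of [x] and [y] yield the same equation from the mean value theorem. *)
wlog: / exists2 s, `|s - x| <= L & 0 = f' s * (y - x).
  apply; move: xyL; rewrite ler_norml => /andP[h1 h2].
  have [le_xy|/ltW le_yx] := leP x y.
    have [s|s /andP[xs sy]] := @mean_value R f f' x y le_xy.
      by move=> /andP[xs sy]; apply: df; rewrite ler_norml; apply/andP; split; lra.
    rewrite fx fy subrr => eq0; exists s => //.
    by rewrite ler_norml; apply/andP; split; lra.
  have [s|s /andP[ys sx]] := @mean_value R f f' y x le_yx.
    by move=> /andP[xs sy]; apply: df; rewrite ler_norml; apply/andP; split; lra.
  rewrite fx fy subrr => eq0; exists s; last by 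
    rewrite -[RHS]opprK -mulrN opprB -eq0 oppr0.
  by rewrite ler_norml; apply/andP; split; lra.
move=> [s /f'N0 f's /esym/eqP]; rewrite mulf_eq0 (negPf f's) /= subr_eq0 eq_sym.
by rewrite (negPf neq_xy).
Qed.

(** Over half a window [f] moves by at least [c * (L / 2)], with opposite signs at [x - L / 2] and
    [x + L / 2]. An error of at most that size leaves [g] with a weak sign change, and the
    intermediate value theorem gives its zero. *)
Lemma steep_neighbour (R : realType) (f f' g : R -> R) (x L c : R) : 0 < L ->
  steep f f' x L c -> f x = 0 ->
  (forall s, `|s - x| <= L -> derivable g s 1) ->
  (forall s, `|s - x| <= L -> `|g s - f s| <= c * (L / 2)) ->
  exists2 y, g y = 0 & `|x - y| <= L / 2.
Proof.
move=> L0 [df sf] fx dg gf.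
have inI s : x - L / 2 <= s <= x + L / 2 -> `|s - x| <= L.
  by move=> /andP[h1 h2]; rewrite ler_norml; apply/andP; split; lra.
have [s1|s1 s1I] := @mean_value R f f' (x - L / 2) x ltac:(lra).
  by move=> /andP[h1 h2]; apply/df/inI/andP; split; lra.
have [s2|s2 s2I] := @mean_value R f f' x (x + L / 2) ltac:(lra).
  by move=> /andP[h1 h2]; apply/df/inI/andP; split; lra.
rewrite fx sub0r subr0 => f2 f1.
have {}s1I : `|s1 - x| <= L.
  by move/andP: s1I => [h1 h2]; apply/inI/andP; split; lra.
have {}s2I : `|s2 - x| <= L.
  by move/andP: s2I => [h1 h2]; apply/inI/andP; split; lra.
have x1I : `|(x - L / 2) - x| <= L by apply/inI/andP; split; lra.
have x2I : `|(x + L / 2) - x| <= L by apply/inI/andP; split; lra.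
move: (gf _ x1I) (gf _ x2I); rewrite !ler_norml => /andP[g1 g1'] /andP[g2 g2'].
have [|//|y yI gy] := @IVT R g (x - L / 2) (x + L / 2) 0 ltac:(lra).
- apply: derivable_within_continuous => s; rewrite in_itv => /inI; exact: dg.
- rewrite ge_min le_max; case: sf => sf.
    have b1 := sf _ s1I; have b2 := sf _ s2I.
    have {}b1 : c * (L / 2) <= f' s1 * (L / 2) by apply: ler_wpM2r => //; lra.
    have {}b2 : c * (L / 2) <= f' s2 * (L / 2) by apply: ler_wpM2r => //; lra.
    by apply/andP; split; apply/orP; [left|right]; lra.
  have b1 := sf _ s1I; have b2 := sf _ s2I.
  have {}b1 : f' s1 * (L / 2) <= - c * (L / 2) by apply: ler_wpM2r => //; lra.
  have {}b2 : f' s2 * (L / 2) <= - c * (L / 2) by apply: ler_wpM2r => //; lra.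
  by apply/andP; split; apply/orP; [right|left]; lra.
exists y => //; move: yI; rewrite in_itv /= => /andP[h1 h2].
by rewrite ler_norml; apply/andP; split; lra.
Qed.

(** At a zero of [f] the value of [Q] is at most [eps], hence [|Q' x| >= gamma - eps]. On the window
    [Q'] varies by at most [C * L = gamma / 4], and [f'] differs from [Q'] by at most [eps]. What
    remains is [gamma - 2 * eps - gamma / 4 >= gamma / 2]. The instance [f = Q] covers [Q]
    itself. *)
Lemma steep_perturbation (R : realType) (Q Q' f f' : R -> R)
    (x gamma eps C : R) :
  0 < gamma -> 0 < C -> eps <= gamma / 8 ->
  (forall s t, `|Q' s - Q' t| <= C * `|s - t|) ->
  gamma <= `|Q x| + `|Q' x| -> `|f x - Q x| <= eps -> f x = 0 ->
  (forall s, `|s - x| <= gamma / (4 * C) -> is_derive s 1 f (f' s)) ->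
  (forall s, `|s - x| <= gamma / (4 * C) -> `|f' s - Q' s| <= eps) ->
  steep f f' x (gamma / (4 * C)) (gamma / 2).
Proof.
move=> g0 C0 epsg lipQ' gQ fQ fx df f'Q'; split => //.
have Q'x : gamma - eps <= `|Q' x|.
  by move: fQ; rewrite fx sub0r normrN => fQ; lra.
have close s : `|s - x| <= gamma / (4 * C) -> `|f' s - Q' x| <= eps + gamma / 4.
  move=> sx; apply: (le_trans (ler_distD (Q' s) _ _)).
  apply: lerD; first exact: f'Q'.
  apply: (le_trans (lipQ' _ _)).
  apply: (le_trans (ler_wpM2l (ltW C0) sx)).
  by rewrite le_eqVlt; apply/orP; left; apply/eqP; field; apply: lt0r_neq0.
have [Q'0|Q'0] := leP 0 (Q' x).
  left=> s /close; rewrite ler_norml => /andP[h1 h2].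
  by move: Q'x; rewrite ger0_norm // => ?; lra.
right=> s /close; rewrite ler_norml => /andP[h1 h2].
by move: Q'x; rewrite ltr0_norm // => ?; lra.
Qed.

(** The first bound in [eps] makes both functions steep with slope [gamma / 2]. The second is the
    error that [steep_neighbour] tolerates for that slope. Counting starts at [a + L], so that the
    windows around the zeros stay in the half-line from [a] on, where the estimates hold. *)
Lemma nzeros_perturbation (R : realType) (Q Q' f f' : R -> R) (a gamma C : R) :
  0 < gamma -> 0 < C ->
  let L := gamma / (4 * C) in
  let eps := Num.min (gamma / 8) (gamma / 2 * (L / 2)) in
  (forall s t, `|Q' s - Q' t| <= C * `|s - t|) ->
  (forall s, a <= s -> gamma <= `|Q s| + `|Q' s|) ->
  (forall s, a <= s -> is_derive s 1 Q (Q' s)) ->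
  (forall s, a <= s -> is_derive s 1 f (f' s)) ->
  (forall s, a <= s -> `|f s - Q s| <= eps) ->
  (forall s, a <= s -> `|f' s - Q' s| <= eps) ->
  forall T, [/\ finite_set (zeros f (a + L) T), finite_set (zeros Q (a + L) T),
    (nzeros f (a + L) T <= (nzeros Q (a + L) T).+2)%N
    & (nzeros Q (a + L) T <= (nzeros f (a + L) T).+2)%N].
Proof.
move=> g0 C0 L eps lipQ' gQ dQ df fQ f'Q' T.
have L0 : 0 < L by rewrite divr_gt0 // mulr_gt0.
have eps8 : eps <= gamma / 8 by rewrite ge_min lexx.
have epsL : eps <= gamma / 2 * (L / 2) by rewrite ge_min lexx orbT.
have eps0 : 0 <= eps.
  by rewrite le_min; apply/andP; split; [|apply: mulr_ge0]; lra.
have geL x s : a + L <= x -> `|s - x| <= L -> a <= s.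
  by move=> ax; rewrite ler_norml => /andP[h1 h2]; lra.
have ge0 x : a + L <= x -> a <= x by move=> ?; lra.
have sQ x : a + L <= x -> Q x = 0 -> steep Q Q' x L (gamma / 2).
  move=> ax Qx; apply: (@steep_perturbation R Q Q' Q Q' x gamma eps C) => //.
  - exact/gQ/ge0.
  - by rewrite subrr normr0.
  - by move=> s /(geL _ _ ax); exact: dQ.
  - by move=> s _; rewrite subrr normr0.
have sf x : a + L <= x -> f x = 0 -> steep f f' x L (gamma / 2).
  move=> ax fx; apply: (@steep_perturbation R Q Q' f f' x gamma eps C) => //.
  - exact/gQ/ge0.
  - exact/fQ/ge0.
  - by move=> s /(geL _ _ ax); exact: df.
  - by move=> s /(geL _ _ ax); exact: f'Q'.
have g20 : 0 < gamma / 2 by rewrite divr_gt0.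
have sepQ x y : a + L <= x -> a + L <= y -> Q x = 0 -> Q y = 0 ->
    x != y -> L < `|x - y|.
  by move=> ax _ Qx Qy; apply: (steep_separated g20 (sQ _ ax Qx)).
have sepf x y : a + L <= x -> a + L <= y -> f x = 0 -> f y = 0 ->
    x != y -> L < `|x - y|.
  by move=> ax _ fx fy; apply: (steep_separated g20 (sf _ ax fx)).
have finf : finite_set (zeros f (a + L) T).
  apply: (@finite_separated _ _ (a + L) T L L0) => [x []//|x y].
  by move=> [/andP[ax _] fx] [/andP[ay _] fy]; apply: sepf.
have finQ : finite_set (zeros Q (a + L) T).
  apply: (@finite_separated _ _ (a + L) T L L0) => [x []//|x y].
  by move=> [/andP[ax _] fx] [/andP[ay _] fy]; apply: sepQ.
split=> //.
  apply: (@nzeros_le_add2 _ _ _ _ _ L) => // x ax fx.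
  apply: (steep_neighbour L0 (sf _ ax fx) fx) => s /(geL _ _ ax) sa.
    by have [] := dQ _ sa.
  by rewrite distrC (le_trans (fQ _ sa)).
apply: (@nzeros_le_add2 _ _ _ _ _ L) => // x ax Qx.
apply: (steep_neighbour L0 (sQ _ ax Qx) Qx) => s /(geL _ _ ax) sa.
  by have [] := df _ sa.
by rewrite (le_trans (fQ _ sa)).
Qed.

(** * Zeros forced by the turning of the argument *)

Lemma cosDpi_int (R : realType) (x : R) (k : int) :
  cos x = 0 -> cos (x + k%:~R * pi) = 0.
Proof.
move=> x0; have nat_case n y : cos y = 0 -> cos (y + n%:R * pi) = 0.
  move=> y0; elim: n => [|n IHn]; first by rewrite mul0r addr0.
  by rewrite -natr1 (mulrDl n%:R) mul1r addrA cosDpi IHn oppr0.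
case: k => n; first exact: nat_case.
by rewrite NegzE mulrNz mulNr -cosN opprD opprK nat_case // cosN.
Qed.

(** The range of [theta] between its end values contains at least [trunc (|theta T - theta a| / pi)]
    points of [pi/2 + pi Z]. Each is attained at some time, and distinct values are attained at
    distinct times. The truncation costs less than 1. *)
Lemma nzeros_ge_arg (R : realType) (f theta : R -> R) (a T : R) :
  a <= T -> {within `[a, T], continuous theta} ->
  (forall t, a <= t <= T -> cos (theta t) = 0 -> f t = 0) ->
  finite_set (zeros f a T) ->
  `|theta T - theta a| / pi - 1 <= (nzeros f a T)%:R.
Proof.
move=> aT ctheta cosf finf.
have pi0 : 0 < pi :> R := pi_gt0 R.
set u := Num.min (theta a) (theta T); set v := Num.max (theta a) (theta T).
have uv : `|theta T - theta a| = v - u.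
  rewrite /u /v; have [h|h] := leP (theta a) (theta T).
    by rewrite ger0_norm // subr_ge0.
  by rewrite ltr0_norm ?opprB // subr_lt0.
have u_le_v : u <= v by rewrite -subr_ge0 -uv.
(* [pi/2 + k0 * pi] is the first such point at or above [u], hence below [u + pi], so the [n] points
   that start there all stay below [v]. *)
set k0 : int := Num.ceil ((u - pi / 2) / pi).
set n := Num.trunc ((v - u) / pi).
pose y (j : nat) : R := pi / 2 + (k0 + j%:Z)%:~R * pi.
have yE j : y j = pi / 2 + k0%:~R * pi + j%:R * pi.
  by rewrite /y intrD (mulrDl k0%:~R) addrA.
have /andP[k1 k2] := ceil_itv ((u - pi / 2) / pi).
have /andP[n1 n2] : n%:R <= (v - u) / pi < n.+1%:R.
  by rewrite truncn_itv // divr_ge0 ?subr_ge0 // ltW.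
move: k1; rewrite -/k0 intrD mulrN1z ltrBlDr -ltrBlDr ltr_pdivlMr // => k1.
move: k2; rewrite -/k0 ler_pdivrMr // => k2.
have y_uv j : (j < n)%N -> u <= y j <= v.
  rewrite -(ler_nat R) -natr1 => jn.
  have j0 : 0 <= j%:R * pi :> R by rewrite mulr_ge0 // ltW.
  have {}jn : j%:R * pi + pi <= n%:R * pi :> R.
    by rewrite -{2}[pi]mul1r -mulrDl ler_pM2r.
  move: n1; rewrite ler_pdivlMr // => n1.
  by rewrite yE; apply/andP; split; lra.
(* For [j >= n] the time [a] is a dummy that makes the choice function total. *)
have ex_t j : exists t, (j < n)%N -> (a <= t <= T) /\ theta t = y j.
  have [jn|_] := ltnP j n; last by exists a.
  have [t] := IVT aT ctheta (y_uv j jn).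
  by rewrite in_itv /= => taT ty; exists t.
have [t tP] := choice ex_t.
have inj_t : {in `I_n &, injective t}.
  move=> i j /set_mem /= ilt /set_mem /= jlt tij.
  have [_ ti] := tP i ilt; have [_ tj] := tP j jlt.
  move: tj; rewrite -tij ti !yE => /addrI /(mulIf (lt0r_neq0 pi0)) /eqP.
  by rewrite eqr_nat => /eqP.
have nf : (n <= nzeros f a T)%N.
  apply: leq_card_fset_set => //.
  rewrite -(card_le_eql (inj_card_eq inj_t)); apply: subset_card_le.
  move=> _ [j /= jn <-]; have [taT tj] := tP j jn; split => //.
  by apply: cosf => //; rewrite tj; apply: cosDpi_int; exact: cos_pihalf.
by move: nf; rewrite -(ler_nat R) uv => nf; move: n2; rewrite -natr1 => n2; lra.
Qed.

(** * Mean motion asymptotics and lower limits at infinity *)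

(** Since [theta T = Omega * T + o(T)], the reverse triangle inequality compares
    [|theta T - theta a|] with [|Omega * (T - a)|]. The constants are absorbed for large [T]. *)
Lemma norm_arg_mean_motion (R : realType) (theta : R -> R) (Omega a K eps : R) :
  theta t / t @[t --> +oo] --> Omega -> 0 < eps ->
  \forall T \near +oo,
    `| `|theta T - theta a| / pi - K - `|Omega| / pi * (T - a)| <= eps * (T - a).
Proof.
move=> /cvgrPdist_le hOmega eps0.
have pi0 : 0 < pi :> R := pi_gt0 R.
(* After multiplication by [pi] the error is at most [e * T + M], and [M <= e * T] for large [T]. As
   [T >= 2 * a] gives [T <= 2 * (T - a)], the total is at most [4 * e * (T - a)]. *)
pose e := eps * pi / 4.
have e0 : 0 < e by rewrite divr_gt0 // mulr_gt0.
pose M := `|theta a - Omega * a| + `|K| * pi.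
have hM := @nbhs_pinfty_ge R (Num.max (Num.max 1 (2 * a)) (M / e)) (num_real _).
apply: filterS2 hM (hOmega e e0) => T; rewrite !ge_max => /andP[/andP[T1 Ta] TM] hT.
have T0 : 0 < T by lra.
have {}hT : `|theta T - Omega * T| <= e * T.
  rewrite distrC; have -> : Omega * T - theta T = (Omega - theta T / T) * T.
    by field; exact: lt0r_neq0.
  by rewrite normrM (gtr0_norm T0) ler_pM2r.
move: TM; rewrite ler_pdivrMr // mulrC => TM.
have -> : `|theta T - theta a| / pi - K - `|Omega| / pi * (T - a) =
    (`|theta T - theta a| - `|Omega| * (T - a) - K * pi) / pi.
  by move: (pi : R) pi0 => q /lt0r_neq0 q0; field.
rewrite normrM normfV (gtr0_norm pi0) ler_pdivrMr //.
apply: (le_trans (ler_normB _ _)); rewrite normrM (gtr0_norm pi0).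
have -> : `|Omega| * (T - a) = `|Omega * (T - a)|.
  by rewrite normrM (@ger0_norm _ (T - a)) // subr_ge0; lra.
have h1 := ler_dist_dist (theta T - theta a) (Omega * (T - a)).
have h2 : `|theta T - theta a - Omega * (T - a)| <=
          `|theta T - Omega * T| + `|theta a - Omega * a|.
  by apply: le_trans (ler_normB _ _); rewrite le_eqVlt; apply/orP; left;
     apply/eqP; congr `|_|; ring.
have h3 : eps * (T - a) * pi = 4 * e * (T - a) by rewrite /e; field.
have h4 : e * (2 * a) <= e * T by rewrite ler_pM2l.
by rewrite h3; move: TM; rewrite /M => TM; lra.
Qed.

(** The lower limit is a supremum, over the sets of the filter, of infima of [f]. The set where
    [l - eps <= f] is one of these sets. *)
Lemma limf_einf_ge (R : realType) (f : R -> R) (l : R) :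
  (forall eps, 0 < eps -> \forall T \near +oo, l - eps <= f T) ->
  (l%:E <= limf_einf (fun T => (f T)%:E) +oo%R)%E.
Proof.
move=> fl; rewrite limf_einfE; apply/lee_addgt0Pr => eps eps0.
have h := fl _ eps0.
rewrite -leeBlDr // -EFinB.
apply: (@le_trans _ _ (ereal_inf [set (f T)%:E | T in [set T | l - eps <= f T]])).
  by apply: le_ereal_inf_tmp => _ [T /= hT <-]; rewrite lee_fin.
by apply: ereal_sup_ubound; exists [set T | l - eps <= f T].
Qed.

(** * Derivatives and decay of single terms *)

Lemma is_derive_sum_cond (R : realType) (n : nat) (B : pred 'I_n)
    (h : 'I_n -> R -> R) (dh : 'I_n -> R) (x : R) :
  (forall i, B i -> is_derive x 1 (h i) (dh i)) ->
  is_derive x 1 (fun t => \sum_(i | B i) h i t) (\sum_(i | B i) dh i).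
Proof.
move=> dhi; rewrite [X in is_derive _ _ _ X]big_mkcond.
have -> : (fun t => \sum_(i | B i) h i t) =
    \sum_(i < n) (if B i then h i else cst 0).
  apply/funext => t; rewrite fct_sumE big_mkcond; apply: eq_bigr => i _.
  by case: ifP.
apply: is_derive_sum => i; case: ifP => [/dhi//|_]; exact: is_derive_cst.
Qed.

Lemma is_derive_cos_affine (R : realType) (w ph x : R) :
  is_derive x 1 (fun t => cos (w * t + ph)) (- (w * sin (w * x + ph))).
Proof.
have d1 : is_derive x 1 (fun t : R => w * t + ph) w.
  by apply: is_derive_eq; rewrite addr0 /GRing.scale /= mulr1.
have := @is_derive1_comp R cos (fun t : R => w * t + ph) x _ _ (is_derive_cos _) d1.
by rewrite /= => h; apply: is_derive_eq; rewrite mulrC mulrN.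
Qed.

Lemma sin_lipschitz (R : realType) (x y : R) : `|sin x - sin y| <= `|x - y|.
Proof.
wlog xy : x y / x <= y => [wlog_le|].
  have [/wlog_le//|/ltW /wlog_le] := leP x y.
  by rewrite distrC (distrC y).
have [s _ eq_sin] := @mean_value R sin cos x y xy (fun s _ => is_derive_sin s).
rewrite distrC eq_sin normrM (distrC y) -[leRHS]mul1r.
by apply: ler_wpM2r => //; exact: cos_max.
Qed.

(** The form [n * x^n / x] avoids the predecessor of [n] and keeps [x^n] as a factor, which exposes
    the logarithmic derivative [n / x]. *)
Lemma is_derive_exprn (R : realType) (n : nat) (x : R) : x != 0 ->
  is_derive x 1 (fun t : R => t ^+ n) (n%:R * x ^+ n / x).
Proof.
move=> x0; have := @is_deriveX R R id n x 1 1 (is_derive_id _ _).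
rewrite exprfctE => h; apply: (@is_derive_eq _ _ _ _ _ _ _ _ h).
rewrite /GRing.scale /= mulr1; case: n {h} => [|n]; first by rewrite !mul0r.
by rewrite /= exprSr mulrA mulfK.
Qed.

(** Growth of a term relative to the dominant one: [beta] stands for [alpha nu - alpha_star alpha]
    and [D] for [d_star alpha d]. It is a quotient of powers because [d] may exceed [D] when
    [beta < 0]. *)
Definition growth (R : realType) (beta : R) (d D : nat) (t : R) : R :=
  expR (beta * t) * t ^+ d / t ^+ D.

Lemma is_derive_growth (R : realType) (beta : R) (d D : nat) (x : R) : 0 < x ->
  is_derive x 1 (growth beta d D)
    ((beta + (d%:R - D%:R) / x) * growth beta d D x).
Proof.
move=> /lt0r_neq0 x0.
have xD0 : x ^+ D != 0 by rewrite expf_neq0.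
have d1 : is_derive x 1 (fun t : R => beta * t) beta.
  by apply: is_derive_eq; rewrite /GRing.scale /= mulr1.
have de := @is_derive1_comp R expR (fun t : R => beta * t) x _ _ (is_derive_expR _) d1.
have dd := is_derive_exprn d x0.
have dD := @is_deriveV R (fun t => t ^+ D) x _ 1 xD0 (is_derive_exprn D x0).
have := is_deriveM (is_deriveM de dd) dD.
move=> h; apply: (@is_derive_eq _ _ _ _ _ _ _ _ h).
rewrite /growth /GRing.scale /= [X in X * _ + _](_ : _ = expR (beta * x) * x ^+ d) //.
by move: (x ^+ D) xD0 => y y0; field; rewrite x0 y0.
Qed.

(** If [beta = 0], the ratio is a negative power of [t]. If [beta < 0], the exponential beats
    [t^(d+1)], and dividing by [t^D] only helps since [t >= 1]. *)
Lemma growth_decay (R : realType) (beta : R) (d D : nat) :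
  beta <= 0 -> (beta = 0 -> (d < D)%N) ->
  exists2 C, 0 <= C & forall t, 1 <= t -> `|growth beta d D t| <= C / t.
Proof.
move=> beta_le0 dD.
have growth0 (t : R) : 1 <= t -> 0 <= growth beta d D t.
  move=> t1; have t0 : 0 <= t by lra.
  by rewrite /growth divr_ge0 ?mulr_ge0 ?expR_ge0 ?exprn_ge0.
have [beta0|beta_neq0] := eqVneq beta 0.
  exists 1 => // t t1; have t0 : 0 < t by lra.
  rewrite ger0_norm ?growth0 // /growth beta0 mul0r expR0 mul1r.
  rewrite ler_pdivrMr ?exprn_gt0 // mulrAC ler_pdivlMr // mul1r -exprSr.
  by rewrite ler_weXn2l // dD.
have b0 : 0 < - beta by rewrite oppr_gt0 lt_neqAle beta_neq0.
(* The constant comes from the term of degree [d + 1] in the series of [exp (- beta * t)], which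
   bounds that exponential from below. *)
exists (d.+1`!%:R / (- beta) ^+ d.+1); first by rewrite divr_ge0 ?exprn_ge0 // ltW.
move=> t t1; have t0 : 0 < t by lra.
rewrite ger0_norm ?growth0 // /growth.
apply: (@le_trans _ _ (expR (beta * t) * t ^+ d)).
  rewrite ler_pdivrMr ?exprn_gt0 // ler_peMr //; last by rewrite exprn_ege1.
  by rewrite mulr_ge0 ?expR_ge0 // exprn_ge0 // ltW.
rewrite ler_pdivlMr // -mulrA -exprSr -[beta * t]opprK expRN -mulNr.
rewrite ler_pdivrMl ?expR_gt0 // mulrA ler_pdivlMr ?exprn_gt0 // -exprMn.
rewrite -ler_pdivrMr ?ltr0n ?fact_gt0 // (mulrC t).
have h := @expR_ge1Dxn R (- beta * t) d (ltW (mulr_gt0 b0 t0)).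
by apply: le_trans h; rewrite lerDr.
Qed.

Definition mode (R : realType) (beta : R) (d D : nat) (H w ph t : R) : R :=
  growth beta d D t * (H * cos (w * t + ph)).

Definition mode' (R : realType) (beta : R) (d D : nat) (H w ph t : R) : R :=
  (beta + (d%:R - D%:R) / t) * growth beta d D t * (H * cos (w * t + ph)) -
  growth beta d D t * (H * (w * sin (w * t + ph))).

Lemma is_derive_mode (R : realType) (beta : R) (d D : nat) (H w ph x : R) :
  0 < x -> is_derive x 1 (mode beta d D H w ph) (mode' beta d D H w ph x).
Proof.
move=> x0.
have h := is_deriveM (is_derive_growth beta d D x0)
  (is_deriveZ H (is_derive_cos_affine w ph x)).
apply: (@is_derive_eq _ _ _ _ _ _ _ _ h); rewrite /mode' /GRing.scale /= /GRing.scale /=.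
by ring.
Qed.

(** Both the term and its derivative are [growth] times [H] times a factor that is bounded for
    [t >= 1], so they inherit the decay of [growth]. *)
Lemma mode_decay (R : realType) (beta : R) (d D : nat) (H w ph : R) :
  beta <= 0 -> (beta = 0 -> (d < D)%N) ->
  exists C, forall t, 1 <= t ->
    `|mode beta d D H w ph t| <= C / t /\ `|mode' beta d D H w ph t| <= C / t.
Proof.
move=> beta_le0 dD; have [C C0 hC] := growth_decay beta_le0 dD.
(* The first three summands bound the trigonometric factor of the derivative. The summand 1 makes
   [K] also bound the cosine in the term itself. *)
pose K : R := `|beta| + `|d%:R - D%:R| + `|w| + 1.
have K1 : 1 <= K by rewrite /K lerDr !addr_ge0.
exists (K * `|H| * C) => t t1; have t0 : 0 < t by lra.
have {}hC := hC t t1.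
have Kt : `|beta + (d%:R - D%:R) / t| + `|w| <= K.
  rewrite -lerBrDr; apply: (le_trans (ler_normD _ _)).
  have : `|(d%:R - D%:R) / t| <= `|d%:R - D%:R :> R|.
    by rewrite normrM normfV (gtr0_norm t0) ler_pdivrMr // ler_peMr.
  by rewrite /K; lra.
have gH a : `|a| <= K -> `|growth beta d D t * (H * a)| <= K * `|H| * C / t.
  move=> aK; rewrite normrM (normrM H) 
    (_ : K * `|H| * C / t = C / t * (`|H| * K)); last first.
    by rewrite -mulrA mulrC (mulrC K).
  by apply: ler_pM; rewrite ?mulr_ge0 ?ler_wpM2l.
split; first by apply: gH; exact: le_trans (cos_max _) K1.
rewrite /mode'; set G := growth _ _ _ _; set e := beta + _.
rewrite (_ : _ - _ = G * (H * (e * cos (w * t + ph) - w * sin (w * t + ph)))); last first.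
  by rewrite mulrBr mulrBr; congr (_ - _); ring.
apply: gH; apply: le_trans Kt; apply: (le_trans (ler_normB _ _)).
by rewrite !normrM lerD // ler_piMr // ?cos_max ?sin_max.
Qed.

Lemma cvgr_dinfty0 (R : realType) (f : R -> R) (C : R) :
  (forall t, 1 <= t -> `|f t| <= C / t) -> f t @[t --> +oo] --> 0.
Proof.
move=> hf; apply/cvgrPdist_le => eps eps0.
have h1 := @nbhs_pinfty_ge R (Num.max 1 (C / eps)) (num_real _).
apply: filterS h1 => t; rewrite ge_max => /andP[t1 tC].
rewrite sub0r normrN (le_trans (hf t t1)) //.
have t0 : 0 < t by lra.
by rewrite ler_pdivrMr // mulrC -ler_pdivrMr.
Qed.

(** * Dominant part and remainder of the exponential-trigonometric sum *)

Definition remainder (R : realType) (k : nat) (alpha : 'I_k.+1 -> R)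
    (d : 'I_k.+1 -> nat) (H omega phi : 'I_k.+1 -> R) (t : R) : R :=
  \sum_(nu | nu \notin dominant alpha d)
    mode (alpha nu - alpha_star alpha) (d nu) (d_star alpha d)
      (H nu) (omega nu) (phi nu) t.

Definition remainder' (R : realType) (k : nat) (alpha : 'I_k.+1 -> R)
    (d : 'I_k.+1 -> nat) (H omega phi : 'I_k.+1 -> R) (t : R) : R :=
  \sum_(nu | nu \notin dominant alpha d)
    mode' (alpha nu - alpha_star alpha) (d nu) (d_star alpha d)
      (H nu) (omega nu) (phi nu) t.

Definition dominant_part' (R : realType) (k : nat) (alpha : 'I_k.+1 -> R)
    (d : 'I_k.+1 -> nat) (H omega phi : 'I_k.+1 -> R) (t : R) : R :=
  \sum_(nu in dominant alpha d) H nu * - (omega nu * sin (omega nu * t + phi nu)).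

Section Decomposition.
Context (R : realType) (k : nat) (alpha : 'I_k.+1 -> R)
  (d : 'I_k.+1 -> nat) (H omega phi : 'I_k.+1 -> R).

Local Notation Q := (dominant_part alpha d H omega phi).
Local Notation Q' := (dominant_part' alpha d H omega phi).
Local Notation P := (remainder alpha d H omega phi).
Local Notation P' := (remainder' alpha d H omega phi).

Lemma exp_trig_sumE (t : R) : 0 < t ->
  exp_trig_sum alpha d H omega phi t =
  expR (alpha_star alpha * t) * t ^+ d_star alpha d * (Q t + P t).
Proof.
move=> t0; set as_ := alpha_star alpha; set ds := d_star alpha d.
have td n : t ^+ n != 0 by rewrite expf_neq0 // lt0r_neq0.
have termE nu : expR (alpha nu * t) * t ^+ d nu * H nu *
      cos (omega nu * t + phi nu) =
    expR (as_ * t) * t ^+ ds *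
      mode (alpha nu - as_) (d nu) ds (H nu) (omega nu) (phi nu) t.
  rewrite /mode /growth (_ : alpha nu * t = as_ * t + (alpha nu - as_) * t); last by ring.
  by rewrite expRD; field.
rewrite /exp_trig_sum (bigID (mem (dominant alpha d))) /= mulrDr.
congr (_ + _); rewrite mulr_sumr; apply: eq_bigr => nu; last by rewrite termE.
rewrite inE => /andP[/eqP -> /eqP ->]; rewrite -/as_ -/ds; ring.
Qed.

(** A non-dominant index has either a smaller exponent than [alpha_star], or the same exponent and a
    smaller power. These are the two cases of [growth_decay]. *)
Lemma remainder_decay : exists C, forall t, 1 <= t ->
  `|P t| <= C / t /\ `|P' t| <= C / t.
Proof.
have ex_C nu : exists C, nu \notin dominant alpha d -> forall t, 1 <= t ->
    `|mode (alpha nu - alpha_star alpha) (d nu) (d_star alpha d)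
      (H nu) (omega nu) (phi nu) t| <= C / t /\
    `|mode' (alpha nu - alpha_star alpha) (d nu) (d_star alpha d)
      (H nu) (omega nu) (phi nu) t| <= C / t.
  case: (boolP (nu \in dominant alpha d)) => [_|ndom]; first by exists 0.
  have [||C hC] := @mode_decay R (alpha nu - alpha_star alpha) (d nu)
      (d_star alpha d) (H nu) (omega nu) (phi nu).
  - by rewrite subr_le0; exact: le_bigmax.
  - move=> /eqP; rewrite subr_eq0 => alphaE.
    rewrite ltn_neqAle; move: ndom; rewrite inE alphaE /= => -> /=.
    exact: leq_bigmax_cond.
  by exists C.
have [C hC] := choice ex_C.
exists (\sum_(nu | nu \notin dominant alpha d) C nu) => t t1.
rewrite /remainder /remainder' mulr_suml.
by split; apply: (le_trans (ler_norm_sum _ _ _)); apply: ler_sum => nu ndom;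
  have [] := hC nu ndom t t1.
Qed.

Lemma is_derive_remainder (t : R) : 0 < t -> is_derive t 1 P (P' t).
Proof.
by move=> t0; apply: is_derive_sum_cond => nu _; exact: is_derive_mode.
Qed.

Lemma is_derive_dominant_part (t : R) : is_derive t 1 Q (Q' t).
Proof.
apply: is_derive_sum_cond => nu _.
exact: (is_deriveZ (H nu) (is_derive_cos_affine (omega nu) (phi nu) t)).
Qed.

(** The sine is 1-Lipschitz, so each term of [Q'] has Lipschitz constant
    [|H nu| * omega nu ^+ 2]. *)
Lemma dominant_part'_lipschitz :
  exists2 C, 0 < C & forall s t, `|Q' s - Q' t| <= C * `|s - t|.
Proof.
pose S := \sum_(nu in dominant alpha d) `|H nu| * omega nu ^+ 2.
have S0 : 0 <= S by apply: sumr_ge0 => nu _; rewrite mulr_ge0 ?sqr_ge0.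
(* The added 1 keeps the constant positive even when [S = 0]; it later serves as a divisor. *)
exists (1 + S); first by lra.
move=> s t; apply: (@le_trans _ _ (S * `|s - t|)); last first.
  by apply: ler_wpM2r => //; lra.
rewrite /dominant_part' -sumrB mulr_suml.
apply: (le_trans (ler_norm_sum _ _ _)); apply: ler_sum => nu _.
rewrite -mulrBr -opprD -mulrBr normrM normrN normrM -mulrA; apply: ler_wpM2l => //.
rewrite -(real_normK (num_real (omega nu))) expr2 -mulrA; apply: ler_wpM2l => //.
apply: (le_trans (sin_lipschitz _ _)); rewrite -normrM le_eqVlt; apply/orP; left.
by apply/eqP; congr `|_|; ring.
Qed.

Lemma Re_dominant_complex (t : R) :
  complex.Re (dominant_complex alpha d H omega phi t) = Q t.
Proof.
rewrite /dominant_complex raddf_sum; apply: eq_bigr => nu _.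
by rewrite /= mul0r subr0.
Qed.

Lemma arg_branch_zero (theta : R -> R) (t : R) :
  arg_branch (dominant_complex alpha d H omega phi) theta -> 0 <= t ->
  cos (theta t) = 0 -> Q t = 0.
Proof.
move=> [_ hz] /hz zE cos0; rewrite -Re_dominant_complex zE.
by rewrite normc_def /= cos0 mulr0 mul0r subrr.
Qed.

End Decomposition.

(** * From the switching function to its dominant part and the mean motion *)

Theorem theorem1 (R : realType) (n : nat) (A : 'M[R]_n) (b p : 'cV[R]_n)
  (hA : has_nonreal_eigenvalue A)
  (hAb : controllable A b)
  (hp : enorm p = 1)
  (k : nat) (alpha : 'I_k.+1 -> R) (d : 'I_k.+1 -> nat)
  (H omega phi : 'I_k.+1 -> R)
  (hH : forall nu, 0 < H nu)
  (homega : forall nu, 0 <= omega nu)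
  (homega_pos : exists nu, 0 < omega nu)
  (hm : forall t : R, 0 <= t ->
     switching A b p t = exp_trig_sum alpha d H omega phi t) :
  let m := switching A b p in
  let Q := dominant_part alpha d H omega phi in
  let z := dominant_complex alpha d H omega phi in
  (exists P : R -> R,
     [/\ forall t : R, 0 < t ->
           m t = expR (alpha_star alpha * t) * t ^+ d_star alpha d * (Q t + P t),
         forall t : R, 0 < t -> derivable P t 1,
         P t @[t --> +oo] --> 0
       & derive1 P t @[t --> +oo] --> 0]) /\
  ((exists2 t : R, 0 <= t & Q t != 0) ->
   (exists2 gamma : R, 0 < gamma &
      forall t : R, 0 <= t -> gamma <= `|Q t| + `|derive1 Q t|) ->
   (forall t : R, 0 <= t -> z t != 0) ->
   forall Omega : R, is_mean_motion z Omega ->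
   exists2 tstar : R, 0 <= tstar &
     let N (T : R) := (nzeros m tstar T)%:R : R in
     let N_Q (T : R) := (nzeros Q tstar T)%:R : R in
     [/\ forall T : R, finite_set (zeros m tstar T) /\ finite_set (zeros Q tstar T),
         N = N_Q +O_ +oo (fun=> 1 : R),
         exists2 r : R -> R, r =o_ +oo (fun T : R => T - tstar) &
           forall T : R, tstar <= T -> `|Omega| / pi * (T - tstar) + r T <= N T
       & ((`|Omega| / pi)%:E <=
            limf_einf (fun T : R => (N T / T)%:E) +oo%R)%E]).
Proof.
move=> m Q z; set P := remainder alpha d H omega phi.
have mE (t : R) : 0 < t ->
    m t = expR (alpha_star alpha * t) * t ^+ d_star alpha d * (Q t + P t).
  by move=> t0; rewrite /m hm ?exp_trig_sumE // ltW.
pose P' := remainder' alpha d H omega phi.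
have dP (t : R) : 0 < t -> is_derive t 1 P (P' t) by exact: is_derive_remainder.
have [CP hCP] := remainder_decay alpha d H omega phi.
split.
  exists P; split => //.
  - by move=> t /dP [].
  - by apply: (@cvgr_dinfty0 _ _ CP) => t /hCP[].
  - apply: (@cvgr_dinfty0 _ _ CP) => t t1; rewrite derive1E.
    by have [_ ->] := dP t (lt_le_trans ltr01 t1); have [] := hCP t t1.
move=> _ [gamma gamma0 hgamma] _ Omega [theta [htheta hOmega]].
pose Q' := dominant_part' alpha d H omega phi.
have dQ (t : R) : is_derive t 1 Q (Q' t) by exact: is_derive_dominant_part.
have {}hgamma (t : R) : 0 <= t -> gamma <= `|Q t| + `|Q' t|.
  by move=> /hgamma; rewrite derive1E; have [_ ->] := dQ t.
have [C C0 lipQ'] := dominant_part'_lipschitz alpha d H omega phi.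
pose L : R := gamma / (4 * C).
pose eps : R := Num.min (gamma / 8) (gamma / 2 * (L / 2)).
have L0 : 0 < L by rewrite divr_gt0 // mulr_gt0.
have eps0 : 0 < eps.
  by rewrite lt_min; apply/andP; split; [|apply: mulr_gt0]; lra.
(* From here on [CP / t <= eps], so the remainder and its derivative are both within the tolerance
   of [nzeros_perturbation]. *)
pose a : R := Num.max 1 (CP / eps).
have a1 : 1 <= a by rewrite le_max lexx.
have small (t : R) : a <= t -> `|P t| <= eps /\ `|P' t| <= eps.
  rewrite ge_max => /andP[t1]; rewrite ler_pdivrMr // => tC.
  have t0 : 0 < t by lra.
  have CPt : CP / t <= eps by rewrite ler_pdivrMr // mulrC.
  by have [h1 h2] := hCP t t1; split; apply: le_trans CPt.
pose F (t : R) : R := Q t + P t; pose F' (t : R) : R := Q' t + P' t.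
have dF (t : R) : 0 < t -> is_derive t 1 F (F' t).
  by move=> t0; have := dQ t; have := dP t t0 => h1 h2; exact: is_deriveD.
have counts (T : R) := @nzeros_perturbation R Q Q' F F' a gamma C gamma0 C0 lipQ'
  (fun s as_ => hgamma s ltac:(lra)) (fun s _ => dQ s)
  (fun s as_ => dF s ltac:(lra))
  (fun s as_ => ltac:(by rewrite /F addrAC subrr add0r; case: (small s as_)))
  (fun s as_ => ltac:(by rewrite /F' addrAC subrr add0r; case: (small s as_))) T.
exists (a + L); first by lra.
set ts := a + L in counts *.
have ts1 : 1 <= ts by rewrite /ts; lra.
(* Since [ts >= 1], the factor between [m] and [F] is positive on the whole interval. *)
have zerosE T : zeros F ts T = zeros m ts T.
  apply/seteqP; split => t [tT].
    by move=> Ft; split=> //; rewrite mE -/(F t) ?Ft ?mulr0 //; 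
       case/andP: tT => ? _; lra.
  have t0 : 0 < t by case/andP: tT => ? _; lra.
  rewrite mE // -/(F t) => /eqP; rewrite !mulf_eq0 expf_eq0 (gt_eqF (expR_gt0 _)).
  by rewrite (gt_eqF t0) andbF => /eqP.
pose N (T : R) : R := (nzeros m ts T)%:R; pose NQ (T : R) : R := (nzeros Q ts T)%:R.
have NE T : N T <= NQ T + 2 /\ NQ T <= N T + 2.
  have [_ _] := counts T; rewrite (_ : nzeros F ts T = nzeros m ts T);
    last by rewrite /nzeros zerosE.
  rewrite -!(ler_nat R) -!(natr1 _.+1) -!natr1 => h1 h2.
  by rewrite /N /NQ; split; lra.
(* The 3 is 1 lost to truncation when counting zeros of [Q], plus 2 lost in passing from [Q] to
   [m]. *)
pose r T := `|theta T - theta ts| / pi - 3 - `|Omega| / pi * (T - ts).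
have hr e : 0 < e -> \forall T \near +oo, `|r T| <= e * (T - ts).
  exact: norm_arg_mean_motion.
have NT T : ts <= T -> `|Omega| / pi * (T - ts) + r T <= N T.
  move=> tsT; have [_ finQ _ _] := counts T; have [_ h2] := NE T.
  have := @nzeros_ge_arg R Q theta ts T tsT.
  have cth : {within `[ts, T], continuous theta}.
    apply: continuous_subspaceW htheta.1 => t /=; rewrite !in_itv /= andbT.
    by move=> /andP[? _]; lra.
  move=> /(_ cth); have cosQ t : ts <= t <= T -> cos (theta t) = 0 -> Q t = 0.
    by move=> /andP[? _]; apply: arg_branch_zero htheta _; lra.
  move=> /(_ cosQ finQ) h3; rewrite /r addrC subrK.
  by move: h2; rewrite /NQ => h2; lra.
have ge_ts : \forall T \near +oo, ts <= T := nbhs_pinfty_ge (num_real ts).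
split=> //.
- by move=> T; have [finF finQ _ _] := counts T; rewrite -zerosE.
- apply/eqaddOP/bigO_exP; exists 2 => //; apply: nearW => T.
  rewrite normr1 mulr1 ler_norml /=; have [h1 h2] := NE T.
  by rewrite -[(N - NQ) T]/(N T - NQ T); apply/andP; split; lra.
- exists r => //; apply/eqoP => e e0; apply: filterS2 ge_ts (hr e e0) => T tsT.
  by rewrite (ger0_norm (x := T - ts)) // subr_ge0.
- apply: limf_einf_ge => e e0; have e20 : 0 < e / 2 by rewrite divr_gt0.
  pose c := `|Omega| / pi.
  (* Half of [e] absorbs the constant [c * ts], the other half absorbs [r T]. *)
  have hM := @nbhs_pinfty_ge R (c * ts / (e / 2)) (num_real _).
  apply: filterS3 ge_ts hM (hr _ e20) => T tsT; rewrite ler_pdivrMr // => TM.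
  rewrite ler_norml => /andP[rT _]; have := NT T tsT; rewrite -/c => NTT.
  have T0 : 0 < T by lra.
  rewrite ler_pdivlMr //.
  have : e / 2 * ts >= 0 by rewrite mulr_ge0 //; lra.
  by move=> h; nra.
Qed.
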